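(* Let $\alpha>0$, let $\{\mathcal{S}_k\}$ be a sequence of measurable subsets of $\Omega$ such that $f_{\mathcal{S}_k,\alpha}\to f_{\mathcal{S},\alpha}$ in $L^2(\Omega)$, and for each $k$ let $x_k\in\mathcal{D}(F)$ be a minimizer over $x\in\mathcal{D}(F)$ of $$\|F(x)-y^\delta\|_{\mathcal{Y}}^2+\|x-x^*\|_{\mathcal{S}_k,\alpha}^2 .$$ Then $\{x_k\}$ has a convergent subsequence (in the norm of $L^2(\Omega)$), and the limit of every convergent subsequence of $\{x_k\}$ is a minimizer of $$\min_{x\in\mathcal{D}(F)}\left\{\|F(x)-y^\delta\|_{\mathcal{Y}}^2+\|x-x^*\|_{\mathcal{S},\alpha}^2\right\}.$$
   Context: Setting. $\Omega\subset\mathbb{R}^n$ is measurable and bounded, $\mathcal{Y}$ is a Hilbert space, and $F:\mathcal{D}(F)\subset L^2(\Omega)\to\mathcal{Y}$ is a (possibly nonlinear) operator which is continuous and weakly sequentially closed, i.e. if $x_n\in\mathcal{D}(F)$, $x_n\rightharpoonup x$ in $L^2(\Omega)$ and $F(x_n)\rightharpoonup z$ in $\mathcal{Y}$, then $x\in\mathcal{D}(F)$ and $F(x)=z$. $\|\cdot\|_2$ is the $L^2(\Omega)$-norm. $\mathcal{S}\subset\Omega$ is a measurable set; for $x\in L^2(\Omega)$, ''$\mathrm{supp}(x)\subset\mathcal{S}$'' means $x=0$ almost everywhere on $\Omega\setminus\mathcal{S}$. The exact data $y\in\mathcal{Y}$ are such that there is an exact solution $x^\dagger\in\mathcal{D}(F)$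 of $F(x^\dagger)=y$ with $\mathrm{supp}(x^\dagger)\subset\mathcal{S}$. The initial guess $x^*\in L^2(\Omega)$ satisfies $\mathrm{supp}(x^* )\subset\mathcal{S}$ and is such that $x^\dagger$ minimizes $\|x-x^*\|_2$ among all $x\in\mathcal{D}(F)$ with $F(x)=y$ and $\mathrm{supp}(x)\subset\mathcal{S}$. The noisy data $y^\delta\in\mathcal{Y}$ satisfy $\|y^\delta-y\|_{\mathcal{Y}}\le\delta$. For $\alpha>0$, a measurable set $A\subset\Omega$ and $x\in L^2(\Omega)$, define $$f_{A,\alpha}(\lambda):=\begin{cases}\sqrt{\alpha}, & \lambda\in A,\\ 1, & \lambda\in\Omega\setminus A,\end{cases}\qquad \|x\|_{A,\alpha}:=\|f_{A,\alpha}\,x\|_2=\left(\alpha\int_{A}|x(\lambda)|^2\,d\lambda+\int_{\Omega\setminus A}|x(\lambda)|^2\,d\lambda\right)^{1/2}.$$ *)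

(* Defs.v *)
From HB Require Import structures.
From mathcomp Require Import all_boot all_order all_algebra.
From mathcomp Require Import sesquilinear.
From mathcomp Require Import all_classical all_reals all_analysis.

Set Implicit Arguments.
Unset Strict Implicit.
Unset Printing Implicit Defensive.

Import Order.TTheory GRing.Theory Num.Theory.
Import numFieldNormedType.Exports.

Local Open Scope classical_set_scope.
Local Open Scope ring_scope.

(* Lebesgue outer measure on R^(n+1), by countable covers with half-open boxes
   ]a, b]; a box with b i < a i for some i is empty and gets volume 0. The
   dimension is n.+1 because the only box of R^0 has volume 1, so that the
   empty set would get outer measure +oo. *)
Section lebesgue_outer.
Context (R : realType) (n : nat).
Local Notation pt := 'rV[R]_n.+1.
Implicit Types (c : pt * pt) (A : set pt).

Definition box c : set pt :=
  [set x | forall i, x ord0 i \in `]c.1 ord0 i, c.2 ord0 i]].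

Definition box_vol c : R :=
  \prod_(i < n.+1) Num.max 0 (c.2 ord0 i - c.1 ord0 i).

Definition box_cover A : set (nat -> pt * pt) :=
  [set c | A `<=` \bigcup_k box (c k)].

Definition lebesgue_outer A : \bar R :=
  ereal_inf [set (\sum_(k <oo) (box_vol (c k))%:E)%E | c in box_cover A].

Local Open Scope ereal_scope.

Lemma box_vol_ge0 c : (0 <= box_vol c)%R.
Proof. by apply: prodr_ge0 => i _; rewrite le_max lexx. Qed.

Lemma lebesgue_outer_ge0 A : 0 <= lebesgue_outer A.
Proof.
apply: le_ereal_inf_tmp => _ [c _ <-]; apply: nneseries_ge0 => k _ _.
by rewrite lee_fin box_vol_ge0.
Qed.

Lemma le_lebesgue_outer : {homo lebesgue_outer : A B / A `<=` B >-> A <= B}.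
Proof.
move=> A B AB; apply/ereal_inf_le_tmp => _ [c Bc <-].
by exists c => //; apply: subset_trans AB Bc.
Qed.

Lemma lebesgue_outer0 : lebesgue_outer set0 = 0.
Proof.
apply/eqP; rewrite eq_le lebesgue_outer_ge0 andbT.
apply: ereal_inf_lbound; exists (fun=> (0, 0)%R); first by move=> x [].
apply: eseries0 => k _ _; rewrite /box_vol big_ord_recl/= mxE subrr maxxx.
by rewrite mul0r.
Qed.

Lemma lebesgue_outer_sigma_subadditive : sigma_subadditive lebesgue_outer.
Proof.
move=> A; have [[i ioo]|] := pselect (exists i, lebesgue_outer (A i) = +oo).
  rewrite (eseries_pinfty _ _ ioo) ?leey// => k _.
  by rewrite -ltNye (lt_le_trans _ (lebesgue_outer_ge0 _)).
rewrite -forallNE => Aoo.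
suff add2e (e : {posnum R}) : lebesgue_outer (\bigcup_k A k) <=
    \sum_(i <oo) lebesgue_outer (A i) + e%:num%:E.
  by apply/lee_addgt0Pr => _/posnumP[].
rewrite (le_trans _ (epsilon_trick _ _ _))//; last first.
  by move=> k; exact: lebesgue_outer_ge0.
pose P k (c : nat -> pt * pt) := box_cover (A k) c /\
  \sum_(j <oo) (box_vol (c j))%:E
    <= lebesgue_outer (A k) + (e%:num / (2 ^ k.+1)%:R)%:E.
have [G PG] : {G : nat -> nat -> pt * pt & forall k, P k (G k)}.
  apply: (@choice _ _ P) => k; rewrite /P /lebesgue_outer.
  set S := (X in ereal_inf X); move infS : (ereal_inf S) => iS.
  case: iS infS => [r Sr|Soo|Soo].
  - have en1 : (0 < e%:num / (2 ^ k.+1)%:R)%R by [].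
    have /(lb_ereal_inf_adherent en1) : ereal_inf S \is a fin_num by rewrite Sr.
    move=> [x [B AB muBx] xS].
    by exists B; split => //; rewrite muBx -Sr; exact/ltW.
  - by have := Aoo k; rewrite /lebesgue_outer Soo.
  - suff : lbound S 0 by move/le_ereal_inf_tmp; rewrite Soo.
    move=> /= _ [B AB <-]; apply: nneseries_ge0 => j _ _.
    by rewrite lee_fin box_vol_ge0.
pose v c := (box_vol c)%:E.
have v0 c : 0 <= v c by rewrite lee_fin box_vol_ge0.
have vG_ge0 x : 0 <= (v \o uncurry G) x by exact: v0.
apply: (@le_trans _ _ (\esum_(i in setT) (v \o uncurry G) i)).
  apply: ereal_inf_lbound => /=.
  have /card_esym/ppcard_eqP[f] := card_nat2.
  exists (uncurry G \o f).
    apply: (@subset_trans _ (\bigcup_i \bigcup_k box (G i k))) => [t [i _]|].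
      by move=> /((PG i).1) -[j _ ?]; exists i => //; exists j.
    move=> t [i _ [j _ Bijt]]; exists (f^-1%FUN (i, j)) => //=.
    by rewrite invK ?inE.
  rewrite -(esum_pred_image (v \o uncurry G) _ xpredT) ?[fun=> _]set_true//.
  by rewrite image_eq.
rewrite (_ : esum _ _ = \sum_(i <oo) \sum_(j <oo ) v (G i j)); last first.
  pose J : nat -> set (nat * nat) := fun i => [set (i, j) | j in setT].
  rewrite (_ : setT = \bigcup_k J k); last first.
    by rewrite predeqE => -[a b]; split => // _; exists a => //; exists b.
  rewrite esum_bigcupT /=; last 2 first.
    - apply/trivIsetP => i j _ _ ij.
      rewrite predeqE => -[k m] /=; split => //= -[] [_] _ [<-{k} _].
      by move=> [m' _] [] /esym/eqP; rewrite (negbTE ij).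
    - by move=> /= [k m]; exact: v0.
  rewrite -(image_id [set: nat]) -fun_true esum_pred_image//; last first.
    by move=> k _; exact: esum_ge0.
  apply: eq_eseriesr => /= j _.
  rewrite -(esum_pred_image (v \o uncurry G) (pair j) predT)//=; last first.
    by move=> ? ? _ _; exact: (@can_inj _ _ _ snd).
  by congr esum; rewrite predeqE => -[a b]; split; move=> [i _ <-]; exists i.
apply: lee_lim.
- apply: is_cvg_nneseries => k *.
  by apply: nneseries_ge0 => m *; exact: v0.
- by apply: is_cvg_nneseries => k *; apply: adde_ge0 => //;
    exact: lebesgue_outer_ge0.
- by near=> k; apply: lee_sum => i _; exact: (PG i).2.
Unshelve. all: by end_near. Qed.

HB.instance Definition _ := isOuterMeasure.Build R pt lebesgue_outer
  lebesgue_outer0 lebesgue_outer_ge0 le_lebesgue_outer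
  lebesgue_outer_sigma_subadditive.

End lebesgue_outer.

(* R^(n+1) with the sigma-algebra of its Lebesgue measurable sets *)
Notation lebRn R n := (caratheodory_type (@lebesgue_outer R n)).

Section lebesgue_rV.
Context (R : realType) (n : nat).

Definition lebesgue_rV : set (lebRn R n) -> \bar R := @lebesgue_outer R n.

HB.instance Definition _ := isMeasure.Build _ _ _ lebesgue_rV
  (caratheodory_measure0 (@lebesgue_outer R n))
  (@caratheodory_measure_ge0 _ _ (@lebesgue_outer R n))
  (@caratheodory_measure_sigma_additive _ _ (@lebesgue_outer R n)).

End lebesgue_rV.

Section L2.
Context (R : realType) (n : nat) (Omega : set (lebRn R n)).
Context (mOmega : measurable Omega).

Definition lebesgue_on : {measure set (lebRn R n) -> \bar R} :=
  mrestr (@lebesgue_rV R n) mOmega.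

(* classes of functions on R^(n+1) modulo equality almost everywhere on Omega;
   what happens outside Omega is not seen by lebesgue_on *)
Definition L2 := LspaceType2 lebesgue_on.

Definition l2fun (x : L2) : lebRn R n -> R := x.

Definition l2norm (f : lebRn R n -> R) : \bar R :=
  'N[lebesgue_on]_2[EFin \o f]%E.

Definition l2dist (x x' : L2) : \bar R := l2norm (l2fun x \- l2fun x').

Definition l2dot (x x' : L2) : R :=
  \int[lebesgue_on]_t (l2fun x t * l2fun x' t).

Definition l2cvg (x_ : nat -> L2) (x : L2) : Prop :=
  l2dist (x_ k) x @[k --> \oo] --> 0%E.

(* By the Riesz representation theorem, testing against inner products is
   testing against bounded linear functionals; same for weak_cvg below. *)
Definition l2weak_cvg (x_ : nat -> L2) (x : L2) : Prop :=
  forall phi : L2, l2dot (x_ k) phi @[k --> \oo] --> l2dot x phi.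

Definition supp_in (A : set (lebRn R n)) (x : L2) : Prop :=
  {ae @lebesgue_rV R n, forall t, (Omega `\` A) t -> l2fun x t = 0}.

Definition weight (A : set (lebRn R n)) (alpha : R) (t : lebRn R n) : R :=
  if t \in A then Num.sqrt alpha else 1.

Definition wnorm (A : set (lebRn R n)) (alpha : R) (f : lebRn R n -> R) :
  \bar R := l2norm (weight A alpha \* f).

End L2.

Section operator.
Context (R : realType) (n : nat) (Omega : set (lebRn R n)).
Context (mOmega : measurable Omega) (Y : completeNormedModType R).
(* Y is a real Hilbert space when dot u u = `|u| ^+ 2 for all u, which is not
   assumed by the definitions of this section. *)
Context (dot : {dot Y for idfun}).
Local Notation L2 := (L2 mOmega).

Definition weak_cvg (u_ : nat -> Y) (u : Y) : Prop :=
  forall v : Y, dot (u_ k) v @[k --> \oo] --> dot u v.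

(* An operator with domain D is a function defined on the whole of L2 whose
   values outside D are never used. *)
Definition continuous_op (D : set L2) (F : L2 -> Y) : Prop :=
  forall x, D x -> forall e : R, 0 < e -> exists2 d : R, 0 < d &
    forall x', D x' -> (l2dist x' x < d%:E)%E -> `|F x' - F x| < e.

Definition weakly_seq_closed (D : set L2) (F : L2 -> Y) : Prop :=
  forall (x_ : nat -> L2) (x : L2) (z : Y), (forall k, D (x_ k)) ->
    l2weak_cvg x_ x -> weak_cvg (F \o x_) z -> D x /\ F x = z.

Definition tikhonov (F : L2 -> Y) (yd : Y) (xs : L2) (alpha : R)
    (A : set (lebRn R n)) (x : L2) : \bar R :=
  ((`|F x - yd| ^+ 2)%R%:E +
     wnorm mOmega A alpha (l2fun x \- l2fun xs)%R ^+ 2)%E.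

Definition minimizer (D : set L2) (J : L2 -> \bar R) (x : L2) : Prop :=
  D x /\ forall x', D x' -> (J x <= J x')%E.

End operator.

(* Main.v *)
Require Import Defs.
From HB Require Import structures.
From mathcomp Require Import all_boot all_order all_algebra.
From mathcomp Require Import sesquilinear.
From mathcomp Require Import all_classical all_reals all_analysis.
From mathcomp Require Import measurable_realfun.
From mathcomp Require Import ring lra.

(** Write [u_k = x_k - xstar], [v_k = F x_k - ydelta], and let [M_k] be the
multiplication by the square of the weight of [S_k], so that the functional
minimized by [x_k] is [J_k(x_k) = |v_k|^2 + <M_k u_k, u_k>]. The densities lie
between [min(alpha, 1)] and [1 + alpha], so comparing [J_k(x_k)] with the value
of [J_k] at one fixed point of the domain bounds [u_k] and [v_k]. Bounded
sequences of a Hilbert space have weakly convergent subsequences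
([weak_compactness], used in L2 and in Y), and the weak closedness of [F] puts
the weak limit [x] in the domain, with [F x] the weak limit of [F x_k].

The point is that [x] is then itself a competitor of [x_k], and that this alone
gives strong convergence: with [u = x - xstar] and [v = F x - ydelta],

  [|v_k - v|^2 + <M_k (u_k - u), u_k - u>
     = J_k(x_k) + J_k(x) - 2 (<v_k, v> + <u_k, M_k u>)
    <= 2 J_k(x) - 2 (<v_k, v> + <u_k, M_k u>)],

and the right-hand side tends to [2 J(x) - 2 J(x) = 0], because [u_k] and [v_k]
converge weakly while [M_k u] converges strongly to [M u]. Since the [M_k] are
uniformly coercive, [x_k] converges to [x] in norm, and [J_k(x_k)] to [J(x)]
([energy_minimizing_strong_cvg]). Finally [J_k(x_k) <= J_k(x')] passes to the
limit for every [x'] in the domain and makes [x] a minimizer of [J].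

The strong convergence of [M_k u] comes from the weights taking only two values:
where the weights of [S_k] and [S] differ, they differ by at least a fixed
amount, so convergence in L2 makes the measure of that set tend to 0
([measure_cvg0_Lnorm2]), and the integral of [u^2] over it with it
([bounded_mul_cvg]).

The Hilbert space arguments take place on square integrable functions, for a
bilinear form which is only semidefinite, and are moved to classes modulo
equality almost everywhere at the end. *)

Set Implicit Arguments.
Unset Strict Implicit.
Unset Printing Implicit Defensive.

Import Order.TTheory GRing.Theory Num.Theory.
Import numFieldNormedType.Exports.

Local Open Scope classical_set_scope.
Local Open Scope ring_scope.

(** * Subsequences *)

Lemma homo_ltn_ge (phi : nat -> nat) :
  {homo phi : i j / (i < j)%N} -> forall n, (n <= phi n)%N.
Proof. by move=> h; elim=> // n IHn; rewrite (leq_ltn_trans IHn)// h. Qed.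

Lemma cvg_subseq (T : topologicalType) (u : nat -> T) (l : T)
  (phi : nat -> nat) : {homo phi : i j / (i < j)%N} ->
  u @ \oo --> l -> (u \o phi) @ \oo --> l.
Proof.
move=> hphi ul; apply: cvg_trans ul; apply: (@cvg_comp _ _ _ phi u _ \oo) => //.
move=> A [N _ NA]; exists N => // n /= Nn; apply: NA.
exact: leq_trans (homo_ltn_ge hphi n).
Qed.

(** The sequence of rows lives in a product of compact intervals, so it has a
cluster point by Tychonoff's theorem. Neighbourhoods of the cluster point that
control finitely many coordinates give the indices one by one. *)
Lemma diagonal_subsequence (R : realType) (a : nat -> nat -> R) (B : R) :
  (forall k j, `|a k j| <= B) ->
  exists2 phi : nat -> nat, {homo phi : i j / (i < j)%N} &
    forall j, cvgn (fun k => a (phi k) j).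
Proof.
move=> aB.
pose K := [set f : nat -> R | forall j : nat, f j \in `[- B, B]].
have cK : @compact (prod_topology (fun _ : nat => R)) K.
  apply: (@tychonoff nat (fun=> R) (fun=> [set` `[- B, B]])) => _.
  exact: segment_compact.
have [|c [_ cl]] := cK (a @ \oo) (fmap_proper_filter _ _).
  by exists 0%N => // k _ j; rewrite /= in_itv/= -ler_norml.
pose nbc := @nbhs _ (prod_topology (fun _ : nat => R)) c.
have Fnbc : Filter nbc by exact: nbhs_filter.
have near1 (j : nat) (e : R) : 0 < e -> nbc [set f | `|f j - c j| < e].
  move=> e0.
  apply: (@proj_continuous nat (fun=> R) j c [set y | `|y - c j| < e]).
  by apply/nbhs_ballP; exists e => //= y; rewrite /ball/= distrC.
have near_c (m : nat) (e : R) : 0 < e ->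
    nbc [set f | forall j, (j <= m)%N -> `|f j - c j| < e].
  move=> e0; elim: m => [|m IHm].
    by apply: (filterS _ (near1 0%N e e0)) => f /= f0 [|j].
  apply: (filterS _ (filterI IHm (near1 m.+1 e e0))) => f /= [fm f0] j.
  by rewrite leq_eqVlt => /predU1P[->//|]; rewrite ltnS => /fm.
have step N m : exists k, (N < k)%N /\
    forall j, (j <= m)%N -> `|a k j - c j| < m.+1%:R^-1.
  have m0 : 0 < m.+1%:R^-1 :> R by rewrite invr_gt0.
  have [|f [[k /= Nk <-] akc]] :=
      cl [set f | exists2 k, (N < k)%N & a k = f] _ _ (near_c m _ m0).
    by exists N.+1 => // k /= Nk; exists k.
  by exists k.
have [g gP] := choice (fun p : nat * nat => step p.1 p.2).
pose phi := fix phi n := if n is n'.+1 then g (phi n', n) else g (0, 0)%N.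
have phi_c n j : (j <= n)%N -> `|a (phi n) j - c j| < n.+1%:R^-1.
  by case: n => [|n]; [exact: (gP (0, 0)%N).2|exact: (gP (phi n, n.+1)).2].
exists phi.
  apply: homo_ltn => [? ? ?|n]; first exact: ltn_trans.
  exact: (gP (phi n, n.+1)).1.
move=> j; apply: (@cvgP _ _ (c j)); apply/cvgrPdist_lt => e e0; near=> n.
rewrite distrC (lt_trans (phi_c n j _))//; first by near: n; exists j.
near: n; exact: near_infty_natSinv_lt (PosNum e0).
Unshelve. all: by end_near. Qed.

(** * Bilinear forms and Hilbert space arguments *)

Lemma sqr_ltr_norm (R : realType) (x e : R) :
  0 < e -> x ^+ 2 < e ^+ 2 -> `|x| < e.
Proof.
move=> /ltW e0 xe; rewrite -(@ltr_pXn2r _ 2) ?nnegrE//.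
by rewrite real_normK ?num_real.
Qed.

(** Definiteness is left out so that the form [\int f g] qualifies on functions,
which it does not separate when they are equal almost everywhere. *)
Record semi_inner (R : realType) (V : lmodType R) (dot : V -> V -> R) : Prop :=
  SemiInner {
    semi_innerC : forall u v, dot u v = dot v u;
    semi_innerPl : forall a u v w, dot (a *: u + v) w = a * dot u w + dot v w;
    semi_inner_ge0 : forall u, 0 <= dot u u }.

Section Hilbert.
Context (R : realType) (V : lmodType R) (dot : V -> V -> R).
Hypothesis dotP : semi_inner dot.
Implicit Types (u v w : V) (W : set V).

Let dotC := semi_innerC dotP.
Let dot_ge0 := semi_inner_ge0 dotP.

Lemma dotDl u v w : dot (u + v) w = dot u w + dot v w.
Proof. by rewrite -[u]scale1r (semi_innerPl dotP) mul1r scale1r. Qed.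

Lemma dot0l w : dot 0 w = 0.
Proof. by have := dotDl 0 0 w; rewrite addr0; lra. Qed.

Lemma dotZl a u w : dot (a *: u) w = a * dot u w.
Proof. by rewrite -[a *: u]addr0 (semi_innerPl dotP) dot0l addr0. Qed.

Lemma dotNl u w : dot (- u) w = - dot u w.
Proof. by rewrite -scaleN1r dotZl mulN1r. Qed.

Lemma dotBl u v w : dot (u - v) w = dot u w - dot v w.
Proof. by rewrite dotDl dotNl. Qed.

Lemma dotDr u v w : dot w (u + v) = dot w u + dot w v.
Proof. by rewrite dotC dotDl !(dotC w). Qed.

Lemma dotZr a u w : dot w (a *: u) = a * dot w u.
Proof. by rewrite dotC dotZl (dotC w). Qed.

Lemma dotNr u w : dot w (- u) = - dot w u.
Proof. by rewrite dotC dotNl (dotC w). Qed.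

Lemma dotBr u v w : dot w (u - v) = dot w u - dot w v.
Proof. by rewrite dotDr dotNr. Qed.

Lemma dotDD u v : dot (u + v) (u + v) = dot u u + 2 * dot u v + dot v v.
Proof. by rewrite !dotDl !dotDr (dotC v u); ring. Qed.

Lemma dotBB u v : dot (u - v) (u - v) = dot u u - 2 * dot u v + dot v v.
Proof. by rewrite !dotBl !dotBr (dotC v u); ring. Qed.

Lemma dotZZ a u : dot (a *: u) (a *: u) = a ^+ 2 * dot u u.
Proof. by rewrite dotZl dotZr mulrA expr2. Qed.

(** Minimize over [t]. When [c = 0] an affine function bounded below is
constant. *)
Lemma discriminant_le (a b c : R) : 0 <= c ->
  (forall t, 0 <= a + 2 * b * t + c * t ^+ 2) -> b ^+ 2 <= a * c.
Proof.
move=> c0 q; have [c_eq0|c_neq0] := eqVneq c 0.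
  have [->|b0] := eqVneq b 0; first by rewrite c_eq0 mulr0 expr0n.
  (* at this t the affine function takes the value - 1 *)
  have := q (- (a + 1) / (2 * b)); rewrite c_eq0 mul0r addr0.
  by rewrite mulrCA divff ?mulf_neq0// mulr1; lra.
have := q (- b / c).
have -> : a + 2 * b * (- b / c) + c * (- b / c) ^+ 2 = (a * c - b ^+ 2) / c.
  by field.
by rewrite pmulr_lge0 ?invr_gt0 ?lt_def ?c_neq0// subr_ge0.
Qed.

Lemma CauchySchwarz_form u v : dot u v ^+ 2 <= dot u u * dot v v.
Proof.
apply: discriminant_le => // t.
have := dot_ge0 (u + t *: v).
by rewrite dotDD dotZZ dotZr mulrA mulrAC (mulrC (t ^+ 2)).
Qed.

Lemma dotD_le u v : dot (u + v) (u + v) <= 2 * dot u u + 2 * dot v v.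
Proof. by have := dot_ge0 (u - v); rewrite dotBB dotDD; lra. Qed.

Definition form_cvg (u_ : nat -> V) u :=
  dot (u_ n - u) (u_ n - u) @[n --> \oo] --> (0 : R).

Definition complete_form := forall u_ : nat -> V,
  (forall e, 0 < e -> exists N, forall i j, (N <= i)%N -> (N <= j)%N ->
     dot (u_ i - u_ j) (u_ i - u_ j) < e) ->
  exists u, form_cvg u_ u.

Lemma sqr_cvg0 (f g : nat -> R) : (forall n, f n ^+ 2 <= g n) ->
  g @ \oo --> 0 -> f @ \oo --> 0.
Proof.
move=> fg /cvgrPdist_lt g0; apply/cvgrPdist_lt => e e0.
have := g0 _ (exprn_gt0 2 e0); apply: filterS => n.
rewrite !sub0r !normrN => gn.
apply: sqr_ltr_norm => //.
by rewrite (le_lt_trans _ gn)// (le_trans (fg n))// ler_norm.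
Qed.

Lemma form_cvg_weak (u_ : nat -> V) u v :
  form_cvg u_ u -> dot (u_ n) v @[n --> \oo] --> dot u v.
Proof.
move=> uu; apply/subr_cvg0.
apply: (@sqr_cvg0 _ (fun n => dot (u_ n - u) (u_ n - u) * dot v v)) => [n|].
  by rewrite -dotBl; exact: CauchySchwarz_form.
by rewrite -[0](mul0r (dot v v)); exact: cvgMl.
Qed.

Lemma weak_strong_cvg (u_ w_ : nat -> V) u w (B : R) :
  (forall n, dot (u_ n) (u_ n) <= B) ->
  dot (u_ n) w @[n --> \oo] --> dot u w ->
  form_cvg w_ w -> dot (u_ n) (w_ n) @[n --> \oo] --> dot u w.
Proof.
move=> uB uw ww.
have -> : (fun n => dot (u_ n) (w_ n)) =
    (fun n => dot (u_ n) (w_ n - w) + dot (u_ n) w).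
  by apply/funext => n; rewrite dotBr subrK.
rewrite -[dot u w]add0r; apply: cvgD => //.
apply: (@sqr_cvg0 _ (fun n => B * dot (w_ n - w) (w_ n - w))) => [n|].
  apply: le_trans (CauchySchwarz_form _ _) _.
  exact: ler_wpM2r.
by rewrite -[0](mulr0 B); exact: cvgMr.
Qed.

(** The vectors against which a bounded sequence converges form a closed set: the
error made by replacing [w] with [w_ m] is uniform in [n]. *)
Lemma weak_cvg_closure (u_ w_ : nat -> V) u w (B : R) :
  (forall n, dot (u_ n) (u_ n) <= B) ->
  (forall m, dot (u_ n) (w_ m) @[n --> \oo] --> dot u (w_ m)) ->
  form_cvg w_ w -> dot (u_ n) w @[n --> \oo] --> dot u w.
Proof.
move=> uB uw /cvgrPdist_lt ww; apply/cvgrPdist_lt => e e0.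
pose C := 2 * B + 2 * dot u u + 1.
have B0 : 0 <= B := le_trans (dot_ge0 _) (uB 0%N).
have C0 : 0 < C by rewrite /C; have := dot_ge0 u; lra.
have e2 : 0 < e / 2 by lra.
have [m _ /(_ m (leqnn m))] := ww _ (divr_gt0 (exprn_gt0 2 e2) C0).
rewrite sub0r normrN ger0_norm// => wm.
have /cvgrPdist_lt/(_ _ e2) := uw m; apply: filterS => n.
rewrite -!dotBl => uwm.
have -> : dot (u - u_ n) w =
    dot (u - u_ n) (w_ m) - dot (u - u_ n) (w_ m - w).
  by rewrite dotBr; ring.
rewrite (le_lt_trans (ler_normB _ _))// [e]splitr ltrD//.
apply: sqr_ltr_norm => //.
apply: le_lt_trans (CauchySchwarz_form _ _) _.
rewrite (@le_lt_trans _ _ (C * dot (w_ m - w) (w_ m - w)))//; last first.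
  by rewrite -ltr_pdivlMl// mulrC.
apply: ler_wpM2r => //; rewrite /C.
have := dotD_le u (- u_ n); rewrite dotNl dotNr opprK.
by have := uB n; lra.
Qed.

(** The representative is a limit of elements of [W], as [W] may fail to be
closed. It is found by minimizing [|u|^2 - 2 ell(u)]: a minimizing sequence is
Cauchy by the parallelogram identity, and its limit satisfies the Euler
equation. With [ell = <v, ->] this is the orthogonal projection of [v] on the
closure of [W].
The hypothesis on [M] is the form of boundedness that makes the minimized
function bounded below at once. *)
Lemma Riesz_subspace (W : set V) (ell : V -> R) (M : R) : complete_form ->
  W 0 -> (forall a u v, W u -> W v -> W (a *: u + v)) ->
  (forall a u v, W u -> W v -> ell (a *: u + v) = a * ell u + ell v) ->
  (forall u, W u -> 2 * ell u <= M + dot u u) ->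
  exists (w_ : nat -> V) (x : V), [/\ forall n, W (w_ n), form_cvg w_ x &
    forall v, W v -> dot x v = ell v].
Proof.
move=> compl W0 WL ellL ellM.
pose E u := dot u u - 2 * ell u.
pose I := [set E u | u in W].
have hI : has_inf I.
  split; first by exists (E 0); exists 0.
  by exists (- M) => _ [u Wu <-]; have := ellM u Wu; rewrite /E; lra.
have infE u : W u -> inf I <= E u.
  by move=> Wu; apply: ge_inf; [exact: hI.2|exists u].
have [w_ w_P] : {w_ : nat -> V & forall n,
    W (w_ n) /\ E (w_ n) < inf I + n.+1%:R^-1}.
  apply: (@choice _ _ (fun n w => W w /\ E w < inf I + n.+1%:R^-1)) => n.
  have n0 : 0 < n.+1%:R^-1 :> R by rewrite invr_gt0.
  by have [_ [w Ww <-] ?] := inf_adherent n0 hI; exists w.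
have Ww n := (w_P n).1.
have ell2 u v : W u -> W v ->
    ell (2^-1 *: (u + v)) = 2^-1 * (ell u + ell v).
  move=> Wu Wv; have Wv2 : W (2^-1 *: v) by rewrite -[_ *: _]addr0; exact: WL.
  rewrite scalerDr ellL// -[2^-1 *: v]addr0 ellL//.
  have ell0 : ell 0 = 0.
    by have := ellL 1 0 0 W0 W0; rewrite scale1r addr0 mul1r; lra.
  by rewrite ell0; lra.
have parallelogram i j :
    dot (w_ i - w_ j) (w_ i - w_ j) < 2 * i.+1%:R^-1 + 2 * j.+1%:R^-1.
  have Wm : W (2^-1 *: (w_ i + w_ j)).
    rewrite scalerDr; apply: (WL) => //; rewrite -[_ *: _]addr0; exact: WL.
  have := infE _ Wm; rewrite /E ell2// dotZZ dotDD.
  have := (w_P i).2; have := (w_P j).2; rewrite /E dotBB.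
  by move: (i.+1%:R^-1) (j.+1%:R^-1) => a b; rewrite [2^-1 ^+ 2]exprVn; lra.
have [|x xP] := compl w_.
  move=> e e0; have e4 : 0 < e / 4 by lra.
  have [N _ NP] := near_infty_natSinv_lt (PosNum e4).
  exists N => i j Ni Nj; have := NP _ Ni; have := NP _ Nj; move=> /=.
  by have := parallelogram i j; move: (i.+1%:R^-1) (j.+1%:R^-1) => a b; lra.
exists w_, x; split => // v Wv.
apply: (@cvg_unique _ _ (dot (w_ n) v @[n --> \oo]) _ _ _) => //.
  exact: form_cvg_weak.
(* E (t v + w_n) >= inf E > E w_n - 1/(n+1) for all t: the discriminant of this
   quadratic in t bounds the defect of w_n in the Euler equation *)
apply/subr_cvg0.
apply: (@sqr_cvg0 _ (fun n => n.+1%:R^-1 * dot v v)) => [n|]; last first.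
  by rewrite -[0](mul0r (dot v v)); apply: cvgMl; exact: cvg_harmonic.
apply: discriminant_le => // t.
have := infE _ (WL t _ _ Wv (Ww n)); have := (w_P n).2.
rewrite /E ellL// dotDD dotZZ dotZl (dotC v (w_ n)).
by move: (n.+1%:R^-1) => a; lra.
Qed.

(** A subsequence has convergent inner products with all the [u_ j]. Let [W] be
the subspace of those [v] such that [<u_(phi n), v>] converges: it contains the
[u_ j]. Let [x] be the Riesz representative of the limit functional on [W]. An
arbitrary [v] acts on the [u_ j] and on [x], a limit of elements of [W], as its
projection [p] does, so it remains to test [p], which is such a limit too. *)
Lemma weak_compactness (u_ : nat -> V) (B : R) : complete_form ->
  (forall n, dot (u_ n) (u_ n) <= B) ->
  exists2 phi : nat -> nat, {homo phi : i j / (i < j)%N} &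
    exists u, forall v, dot (u_ (phi n)) v @[n --> \oo] --> dot u v.
Proof.
move=> compl uB.
have [|phi hphi phiP] :=
    @diagonal_subsequence R (fun k j => dot (u_ k) (u_ j)) B.
  move=> k j; have B0 : 0 <= B := le_trans (dot_ge0 _) (uB 0%N).
  rewrite -(@ler_pXn2r _ 2) ?nnegrE// real_normK ?num_real//.
  by rewrite (le_trans (CauchySchwarz_form _ _))// [B ^+ 2]expr2 ler_pM.
exists phi => //.
pose x_ n := u_ (phi n).
pose W := [set v | cvgn (fun n => dot (x_ n) v)].
pose ell v := limn (fun n => dot (x_ n) v).
have Wlim v : W v -> dot (x_ n) v @[n --> \oo] --> ell v by [].
have WL a u v : W u -> W v ->
    dot (x_ n) (a *: u + v) @[n --> \oo] --> a * ell u + ell v.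
  move=> Wu Wv; under eq_fun do rewrite dotDr dotZr.
  by apply: cvgD; [apply: cvgMr; exact: Wlim|exact: Wlim].
have W0 : W 0.
  by apply: (@cvgP _ _ 0); under eq_fun do rewrite dotC dot0l; exact: cvg_cst.
have W_lin a u v : W u -> W v -> W (a *: u + v).
  by move=> Wu Wv; apply: cvgP; exact: WL.
have ell_lin a u v : W u -> W v -> ell (a *: u + v) = a * ell u + ell v.
  by move=> Wu Wv; apply/cvg_lim => //; exact: WL.
have [|w_ [x [Ww wx xE]]] := Riesz_subspace compl W0 W_lin ell_lin (M := B).
  move=> v Wv; rewrite -ler_pdivlMl//; apply: limr_le => //.
  apply: nearW => n; rewrite ler_pdivlMl//.
  have := dot_ge0 (x_ n - v); rewrite dotBB.
  by have := uB (phi n); rewrite /x_; lra.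
exists x => v.
have [||p_ [p [Wp pp pE]]] :=
    Riesz_subspace compl W0 W_lin (ell := dot v) (M := dot v v).
- by move=> a u w _ _; rewrite dotDr dotZr.
- by move=> u _; have := dot_ge0 (v - u); rewrite dotBB; lra.
have -> : (fun n => dot (u_ (phi n)) v) = (fun n => dot (x_ n) p).
  by apply/funext => n; rewrite dotC -pE 1?dotC//; exact: phiP.
have -> : dot x v = dot x p.
  apply: (@cvg_unique _ _ (dot (w_ n) v @[n --> \oo]) _ _ _) => //.
    exact: form_cvg_weak.
  have -> : (fun n => dot (w_ n) v) = (fun n => dot (w_ n) p).
    by apply/funext => n; rewrite dotC -pE 1?dotC.
  exact: form_cvg_weak.
apply: (@weak_cvg_closure x_ p_ x p B) => // m; first exact: uB.
by rewrite xE//; exact: Wlim.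
Qed.

End Hilbert.

(** * From weak to strong convergence of minimizers *)

Section weighted_energy.
Context (R : realType) (H Y : lmodType R).
Context (dotH : H -> H -> R) (dotY : Y -> Y -> R).
Hypotheses (dotHP : semi_inner dotH) (dotYP : semi_inner dotY).
Context (M_ : nat -> H -> H) (M : H -> H).
Hypothesis M_sym : forall n u v, dotH (M_ n u) v = dotH u (M_ n v).
Hypothesis M_cvg : forall u, form_cvg dotH (M_ ^~ u) (M u).

Lemma energy_cvg u v :
  dotY v v + dotH (M_ n u) u @[n --> \oo] --> dotY v v + dotH (M u) u.
Proof. by apply: cvgD; [exact: cvg_cst|exact: form_cvg_weak]. Qed.

(** Expand the energy of the difference, [a n] below: minimality bounds it by
twice the energy of the weak limit minus twice the cross term [X n], and both
have the same limit. *)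
Lemma energy_minimizing_strong_cvg (c B : R)
    (u_ : nat -> H) (v_ : nat -> Y) u v :
  0 < c -> (forall n w, c * dotH w w <= dotH (M_ n w) w) ->
  (forall n, dotH (u_ n) (u_ n) <= B) ->
  (forall w, dotH (u_ n) w @[n --> \oo] --> dotH u w) ->
  (forall w, dotY (v_ n) w @[n --> \oo] --> dotY v w) ->
  (forall n, dotY (v_ n) (v_ n) + dotH (M_ n (u_ n)) (u_ n) <=
             dotY v v + dotH (M_ n u) u) ->
  form_cvg dotH u_ u /\
  dotY (v_ n) (v_ n) + dotH (M_ n (u_ n)) (u_ n) @[n --> \oo] -->
    dotY v v + dotH (M u) u.
Proof.
move=> c0 coer uB uu vv opt.
pose X n := dotY (v_ n) v + dotH (u_ n) (M_ n u).
pose Q n := dotY v v + dotH (M_ n u) u.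
pose a n := dotY (v_ n - v) (v_ n - v) + dotH (M_ n (u_ n - u)) (u_ n - u).
have X_cvg : X @ \oo --> dotY v v + dotH (M u) u.
  apply: cvgD; first exact: vv.
  rewrite (semi_innerC dotHP (M u)).
  by apply: (weak_strong_cvg dotHP uB); [exact: uu|exact: M_cvg].
have Q_cvg : Q @ \oo --> dotY v v + dotH (M u) u by exact: energy_cvg.
have aE n : dotY (v_ n) (v_ n) + dotH (M_ n (u_ n)) (u_ n) =
    a n - Q n + 2 * X n.
  rewrite /a /Q /X (dotBB dotYP) (M_sym n (u_ n - u)) (dotBl dotHP).
  rewrite -!M_sym !(dotBr dotHP).
  by rewrite (semi_innerC dotHP (M_ n u) (u_ n)) -M_sym; ring.
have a0 : a @ \oo --> 0.
  apply: (@squeeze_cvgr _ _ _ _ (fun=> 0) (fun n => 2 * (Q n - X n))).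
  - apply: nearW => n; apply/andP; split.
      rewrite /a addr_ge0// ?(semi_inner_ge0 dotYP)// (le_trans _ (coer _ _))//.
      by rewrite mulr_ge0 ?(ltW c0) ?(semi_inner_ge0 dotHP).
    have := opt n; rewrite aE -/(Q n); lra.
  - exact: cvg_cst.
  - rewrite -[0](mulr0 2); apply: cvgMr.
    by rewrite -(subrr (dotY v v + dotH (M u) u)); exact: cvgB.
split; last first.
  rewrite (_ : (fun n => _) = (fun n => a n - Q n + 2 * X n)); last first.
    by apply/funext => n; rewrite aE.
  set q := dotY v v + dotH (M u) u in X_cvg Q_cvg *.
  have -> : q = 0 - q + 2 * q by ring.
  by apply: cvgD; [exact: cvgB|exact: cvgMr].
apply: (@squeeze_cvgr _ _ _ _ (fun=> 0) (fun n => c^-1 * a n)).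
- apply: nearW => n; rewrite (semi_inner_ge0 dotHP)/= ler_pdivlMl//.
  by rewrite (le_trans (coer n _))// lerDr (semi_inner_ge0 dotYP).
- exact: cvg_cst.
- by rewrite -[0](mulr0 c^-1); exact: cvgMr.
Qed.

End weighted_energy.

(** * Completeness of the space of square integrable functions *)

(** Since [|d| <= d^2 / w + w], summability of [w] and of [d^2 / w] makes the
increments absolutely summable. This turns bounds on squares, which integrate
termwise, into pointwise convergence. *)
Lemma weighted_telescope_cvg (R : realType) (g w : nat -> R) :
  (forall m, 0 < w m) -> (\sum_(m <oo) (w m)%:E < +oo)%E ->
  (\sum_(m <oo) ((g m.+1 - g m) ^+ 2 / w m)%:E < +oo)%E -> cvgn g.
Proof.
move=> w0 wfin hfin.
pose h m := (g m.+1 - g m) ^+ 2 / w m.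
have h0 m : 0 <= h m by rewrite /h divr_ge0 ?sqr_ge0// ltW.
have partial (f : nat -> R) N : (forall m, 0 <= f m) ->
    (\sum_(m <oo) (f m)%:E < +oo)%E ->
    \sum_(0 <= m < N) f m <= fine (\sum_(m <oo) (f m)%:E)%E.
  move=> f0 ffin; rewrite -lee_fin fineK; last first.
    by rewrite ge0_fin_numE// nneseries_ge0// => m _ _; rewrite lee_fin.
  by rewrite -sumEFin; apply: nneseries_lim_ge => m _ _; rewrite lee_fin.
have : cvgn [normed series (telescope g)].
  apply: nondecreasing_is_cvgn.
    apply/nondecreasing_seqP => n; rewrite -subr_ge0 seriesSB; exact: normr_ge0.
  exists (fine (\sum_(m <oo) (h m)%:E)%E + fine (\sum_(m <oo) (w m)%:E)%E).
  move=> _ [N _ <-].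
  rewrite /normed_series_of seriesEnat/=.
  apply: le_trans (lerD (partial h N h0 hfin) (partial w N _ wfin)); last first.
    by move=> m; exact: ltW.
  rewrite -big_split/=; apply: ler_sum => m _; rewrite /telescope /h.
  set d := g m.+1 - g m; have wm := w0 m.
  rewrite -(@ler_pM2r _ (w m))// mulrDl divfK ?gt_eqF//.
  have := sqr_ge0 (`|d| - w m); have := real_normK (num_real d).
  by have := normr_ge0 d; nra.
move/normed_cvg => cs.
rewrite (_ : g = (fun n => g 0%N + series (telescope g) n)); last first.
  by apply/funext => n; rewrite -eq_sum_telescope.
by apply: is_cvgD => //; exact: is_cvg_cst.
Qed.

Section L2_functions.
Context d (T : measurableType d) (R : realType).
Variable mu : {measure set T -> \bar R}.

(** Square integrable functions, not taken modulo equality almost everywhere. *)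
Definition L2fun := LfunType mu (lee1n 2).

Definition L2dot (f g : L2fun) : R := \int[mu]_t (f t * g t).

Lemma L2fun_prod_integrable (f g : L2fun) :
  mu.-integrable setT (EFin \o (f \* g)%R).
Proof.
by apply/Lfun1_integrable; apply: Lfun2_mul_Lfun1; exact: LfunP.
Qed.

Lemma L2dot_semi_inner : semi_inner L2dot.
Proof.
split=> [f g|a f g h|f].
- by apply: eq_Rintegral => t _; rewrite mulrC.
- rewrite /L2dot -RintegralZl//; last exact: L2fun_prod_integrable.
  rewrite -RintegralD//; last 2 first.
  + apply: eq_integrable (integrableZl _ a (L2fun_prod_integrable f h)) => //.
  + exact: L2fun_prod_integrable.
  by apply: eq_Rintegral => t _; rewrite /= mulrDl mulrA.
- by apply: Rintegral_ge0 => t _; rewrite -expr2 sqr_ge0.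
Qed.

Lemma EFin_L2dot (f : L2fun) :
  (L2dot f f)%:E = (\int[mu]_t ((f t) ^+ 2)%:E)%E.
Proof.
rewrite /L2dot /Rintegral fineK; last first.
  by apply: integrable_fin_num => //; exact: L2fun_prod_integrable.
by apply: eq_integral => t _; rewrite expr2.
Qed.

Lemma Lnorm2E (f : T -> R) :
  'N[mu]_2[EFin \o f]%E = ((\int[mu]_t ((f t) ^+ 2)%:E) `^ 2^-1)%E.
Proof.
rewrite unlock; congr (_ `^ _)%E; apply: eq_integral => t _ /=.
by rewrite powR_mulrn// real_normK// num_real.
Qed.

Lemma Lnorm2_L2dot (f : L2fun) :
  'N[mu]_2[EFin \o f]%E = (Num.sqrt (L2dot f f))%:E.
Proof.
rewrite Lnorm2E -EFin_L2dot poweR_EFin powR12_sqrt//.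
exact: (semi_inner_ge0 L2dot_semi_inner).
Qed.

Lemma Lfun2P (f : T -> R) : measurable_fun setT f ->
  (\int[mu]_t ((f t) ^+ 2)%:E < +oo)%E -> f \in Lfun mu 2%:E.
Proof.
move=> mf ff; rewrite inE; apply/andP; split; rewrite inE//=.
by rewrite /finite_norm Lnorm2E poweR_lty.
Qed.

Lemma limn_einf_le (u : (\bar R)^nat) (l : \bar R) N :
  (forall n, (N <= n)%N -> (u n <= l)%E) -> (limn_einf u <= l)%E.
Proof.
move=> ul; rewrite limn_einf_lim (cvg_lim _ (@cvg_einfs_sup _ u))//.
apply: ge_ereal_sup => _ [n _ <-].
apply: le_trans (ul (maxn n N) _); last exact: leq_maxr.
by apply: ereal_inf_lbound; exists (maxn n N) => //=; exact: leq_maxl.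
Qed.

Lemma limn_einf_ge0 (u : (\bar R)^nat) :
  (forall n, (0 <= u n)%E) -> (0 <= limn_einf u)%E.
Proof.
move=> u0; rewrite limn_einf_lim (cvg_lim _ (@cvg_einfs_sup _ u))//.
apply: (@le_trans _ _ (einfs u 0%N)).
  by apply: le_ereal_inf_tmp => _ [n _ <-].
by apply: ereal_sup_ubound; exists 0%N.
Qed.

(** A subsequence [g] with increments small in L2 converges almost everywhere,
because [\sum_m (g m.+1 - g m)^2 / w m] has a finite integral. Fatou's lemma
bounds the distance from [u_ n] to the pointwise limit by the Cauchy bounds. *)
Lemma L2_complete : complete_form L2dot.
Proof.
move=> u_ u_cauchy.
pose w m : R := 1 / (2 ^ m.+1)%:R.
have w0 m : 0 < w m by rewrite /w divr_gt0// ltr0n expn_gt0.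
have wfin : (\sum_(m <oo) (w m)%:E < +oo)%E.
  have := @epsilon_trick R (fun=> 0%E) 1 xpredT (fun=> lexx _) ler01.
  rewrite [X in (_ <= X + _)%E]eseries0// add0e => wle1.
  apply: le_lt_trans (ltry 1); apply: le_trans wle1.
  by under [leRHS]eq_eseriesr do rewrite add0e.
have /choice[N NP] m : exists N, forall i j, (N <= i)%N -> (N <= j)%N ->
    L2dot (u_ i - u_ j) (u_ i - u_ j) < w m ^+ 2.
  by apply: u_cauchy; rewrite exprn_gt0.
pose s m := (m + \sum_(i < m.+1) N i)%N.
have sm m : (m <= s m)%N by exact: leq_addr.
have sN m : (N m <= s m)%N by rewrite /s big_ord_recr/= addnA leq_addl.
have s_mono : {homo s : i j / (i <= j)%N}.
  apply: homo_leq => // [? ? ?|n]; first exact: leq_trans.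
  by rewrite /s [in leqRHS]big_ord_recr/= leq_add// leq_addr.
pose g m : L2fun := u_ (s m).
pose h m t := ((g m.+1 t - g m t) ^+ 2 / w m)%:E.
have mg m : measurable_fun setT (g m) by [].
have mh m : measurable_fun setT (h m).
  apply/measurable_EFinP; apply: measurable_funM => //.
  by apply: measurable_funX; exact: measurable_funB.
have h0 m t : (0 <= h m t)%E.
  by rewrite lee_fin divr_ge0 ?sqr_ge0 ?ltW.
have inth m : (\int[mu]_t h m t <= (w m)%:E)%E.
  rewrite /h; under eq_integral do rewrite EFinM.
  rewrite ge0_integralZr//; last 3 first.
  - by apply/measurable_EFinP; apply: measurable_funX; exact: measurable_funB.
  - by move=> t _; rewrite lee_fin sqr_ge0.
  - by rewrite lee_fin invr_ge0 ltW.
  have := EFin_L2dot (g m.+1 - g m); rewrite /= => <-.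
  rewrite -EFinM lee_fin ler_pdivrMr// -expr2 ltW//.
  apply: NP => //; apply: leq_trans (sN m) _; exact: s_mono.
have mH : measurable_fun setT (fun t => \sum_(m <oo) h m t)%E.
  by apply: ge0_emeasurable_sum => // m t _ _.
have intH : mu.-integrable setT (fun t => \sum_(m <oo) h m t)%E.
  apply/integrableP; split => //.
  under eq_integral do rewrite gee0_abs ?nneseries_ge0//.
  rewrite integral_nneseries//.
  apply: le_lt_trans wfin; apply: lee_nneseries => // m _ _.
  exact: integral_ge0.
have cvg_ae : {ae mu, forall t, cvgn (g ^~ t)}.
  apply: filterS (integrable_ae measurableT intH) => t /(_ I) tfin.
  apply: (weighted_telescope_cvg w0 wfin).
  by rewrite -ge0_fin_numE// nneseries_ge0// => m _ _; exact: h0.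
pose f t := fine (limn_esup (fun m => (g m t)%:E)).
have mf : measurable_fun setT f.
  apply: measurableT_comp => //; apply: measurable_fun_limn_esup => m.
  by apply/measurable_EFinP.
have g_f : {ae mu, forall t, g m t @[m --> \oo] --> f t}.
  apply: filterS cvg_ae => t ct.
  suff -> : f t = limn (g ^~ t) by [].
  rewrite /f; have gE : (fun m => (g m t)%:E) @ \oo --> (limn (g ^~ t))%:E.
    by apply/cvg_EFin; [exact: nearW|].
  by rewrite is_cvg_limn_esupE ?(cvg_lim _ gE)//; apply: cvgP gE.
have key n e N0 :
    (forall m, (N0 <= m)%N -> L2dot (g m - u_ n) (g m - u_ n) <= e) ->
    (\int[mu]_t ((f t - u_ n t) ^+ 2)%:E <= e%:E)%E.
  move=> ge.
  have mq m : measurable_fun setT (fun t => ((g m t - u_ n t) ^+ 2)%:E).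
    by apply/measurable_EFinP; apply: measurable_funX; exact: measurable_funB.
  apply: (@le_trans _ _
    (\int[mu]_t limn_einf (fun m => ((g m t - u_ n t) ^+ 2)%:E))%E).
    apply: ae_ge0_le_integral => //.
    - by move=> t _; rewrite lee_fin sqr_ge0.
    - apply/measurable_EFinP; apply: measurable_funX; exact: measurable_funB.
    - by move=> t _; apply: limn_einf_ge0 => m; rewrite lee_fin sqr_ge0.
    - under eq_fun do rewrite -[limn_einf _]oppeK -limn_esupN.
      apply: measurableT_comp => //; apply: measurable_fun_limn_esup => m.
      by apply: measurableT_comp => //; exact: mq.
    apply: filterS g_f => t gt _.
    have qE : (fun m => ((g m t - u_ n t) ^+ 2)%:E) @ \oo -->
        ((f t - u_ n t) ^+ 2)%:E.
      apply/cvg_EFin; first exact: nearW.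
      rewrite expr2; under eq_fun do rewrite /= expr2.
      by apply: cvgM; apply: cvgB => //; exact: cvg_cst.
    by rewrite is_cvg_limn_einfE ?(cvg_lim _ qE)//; apply: cvgP qE.
  apply: le_trans (fatou mu measurableT mq _) _.
    by move=> m t _; rewrite lee_fin sqr_ge0.
  apply: (@limn_einf_le _ _ N0) => m Nm.
  have := EFin_L2dot (g m - u_ n); rewrite /= => <-.
  by rewrite lee_fin ge.
have {key} key e : 0 < e -> exists N0, forall n, (N0 <= n)%N ->
    (\int[mu]_t ((f t - u_ n t) ^+ 2)%:E <= e%:E)%E.
  move=> /u_cauchy[N0 N0P]; exists N0 => n Nn; apply: (key n e N0) => m Nm.
  by rewrite ltW// N0P// (leq_trans Nm).
have [N0 /(_ _ (leqnn _)) fu] := key 1 ltr01.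
have fL : f \in Lfun mu 2%:E.
  have -> : f = (fun t => f t - u_ N0 t) \+ u_ N0.
    by apply/funext => t; rewrite /= subrK.
  have fuL : (fun t => f t - u_ N0 t) \in Lfun mu 2%:E.
    apply: Lfun2P; first exact: measurable_funB.
    by apply: le_lt_trans fu _; exact: ltry.
  exact: (@Lfun_addr_closed _ _ _ mu 2%:E (lee1n 2)).2 _ _ fuL (LfunP (u_ N0)).
exists (Lfun_Sub _ fL); apply/cvgrPdist_lt => e e0.
have e2 : 0 < e / 2 by rewrite divr_gt0.
have [N1 N1P] := key _ e2; exists N1 => // n /= /N1P fun_le.
rewrite sub0r normrN ger0_norm; last exact: (semi_inner_ge0 L2dot_semi_inner).
have {fun_le}: L2dot (u_ n - Lfun_Sub _ fL) (u_ n - Lfun_Sub _ fL) <= e / 2.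
  rewrite -lee_fin EFin_L2dot; apply: le_trans fun_le.
  by under eq_integral do rewrite /= -sqrrN opprB.
by move/le_lt_trans; apply; rewrite ltr_pdivrMr// ltr_pMr// ltr1n.
Qed.

End L2_functions.

(** * Multiplication by bounded functions *)

Section bounded_multiplier.
Context d (T : measurableType d) (R : realType).
Variable mu : {measure set T -> \bar R}.
Local Notation L2fun := (L2fun mu).
Local Notation L2dot := (@L2dot _ _ _ mu).

Lemma Lfun2_bounded_mul (a : T -> R) (C : R) (f : L2fun) :
  measurable_fun setT a -> (forall t, `|a t| <= C) ->
  a \* f \in Lfun mu 2%:E.
Proof.
move=> ma aC; apply: Lfun2P; first exact: measurable_funM.
apply: (@le_lt_trans _ _ ((C ^+ 2)%:E * (L2dot f f)%:E)%E); last first.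
  by rewrite -EFinM ltry.
rewrite EFin_L2dot -ge0_integralZl_EFin ?sqr_ge0//; last 2 first.
- by move=> t _; rewrite lee_fin sqr_ge0.
- by apply/measurable_EFinP; apply: measurable_funX.
apply: ge0_le_integral => //.
- by move=> t _; rewrite lee_fin sqr_ge0.
- by apply/measurable_EFinP; apply: measurable_funX; apply: measurable_funM.
- apply/measurable_EFinP; apply: measurable_funM => //.
  exact: measurable_funX.
- move=> t _; rewrite -EFinM lee_fin exprMn ler_wpM2r ?sqr_ge0//.
  rewrite -[a t ^+ 2]real_normK ?num_real// lerXn2r ?nnegrE//.
  by rewrite (le_trans _ (aC t)).
Qed.

Definition bounded_mul (a : T -> R) (C : R) (ma : measurable_fun setT a)
    (aC : forall t, `|a t| <= C) (f : L2fun) : L2fun :=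
  Lfun_Sub (lee1n 2) (Lfun2_bounded_mul f ma aC).

Lemma bounded_mul_sym a C ma aC f g :
  L2dot (@bounded_mul a C ma aC f) g = L2dot f (bounded_mul ma aC g).
Proof. by apply: eq_Rintegral => t _ /=; rewrite mulrCA mulrA. Qed.

Lemma bounded_mul_ge a C ma aC (c : R) f : (forall t, c <= a t) ->
  c * L2dot f f <= L2dot (@bounded_mul a C ma aC f) f.
Proof.
move=> ca; rewrite /L2dot -RintegralZl//; last exact: L2fun_prod_integrable.
apply: le_Rintegral => //.
- exact: (integrableZl measurableT c (L2fun_prod_integrable f f)).
- exact: (L2fun_prod_integrable (bounded_mul ma aC f) f).
- by move=> t _ /=; rewrite -mulrA ler_wpM2r// -expr2 sqr_ge0.
Qed.

Lemma bounded_mul_le a C ma aC f :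
  L2dot (@bounded_mul a C ma aC f) f <= C * L2dot f f.
Proof.
rewrite /L2dot -RintegralZl//; last exact: L2fun_prod_integrable.
apply: le_Rintegral => //.
- exact: (L2fun_prod_integrable (bounded_mul ma aC f) f).
- exact: (integrableZl measurableT C (L2fun_prod_integrable f f)).
- move=> t _ /=; rewrite -mulrA ler_wpM2r -?expr2 ?sqr_ge0//.
  exact: le_trans (ler_norm _) (aC t).
Qed.

Lemma measurable_neq_fun (a b : T -> R) :
  measurable_fun setT a -> measurable_fun setT b ->
  measurable [set t | a t != b t].
Proof.
move=> ma mb.
have := measurable_funB ma mb measurableT
  (measurableC (measurable_set1 (0 : R))).
rewrite setTI; congr measurable; apply/seteqP; split=> t /=.
  by move=> /eqP; rewrite subr_eq0.
by rewrite -subr_eq0 => /eqP.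
Qed.

(** Chebyshev's inequality: [k * mu (E_ n)] is at most the squared L2 norm. *)
Lemma measure_cvg0_Lnorm2 (a_ : nat -> T -> R) (a : T -> R)
    (E_ : nat -> set T) (k : R) : 0 < k ->
  (forall n, measurable_fun setT (a_ n)) -> measurable_fun setT a ->
  (forall n, measurable (E_ n)) ->
  (forall n t, E_ n t -> k <= (a_ n t - a t) ^+ 2) ->
  ('N[mu]_2[EFin \o (a_ n \- a)%R] @[n --> \oo] --> 0)%E ->
  forall e : R, 0 < e -> \forall n \near \oo, (mu (E_ n) < e%:E)%E.
Proof.
move=> k0 ma_ ma mE ka Ncvg e e0.
have ke0 : 0 < Num.sqrt (k * e) by rewrite sqrtr_gt0 mulr_gt0.
have mq n : measurable_fun setT (fun t => ((a_ n t - a t) ^+ 2)%:E).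
  by apply/measurable_EFinP; apply: measurable_funX; exact: measurable_funB.
have : \forall n \near \oo,
    ('N[mu]_2[EFin \o (a_ n \- a)%R] < (Num.sqrt (k * e))%:E)%E.
  apply: (Ncvg [set y | y < (Num.sqrt (k * e))%:E]%E).
  apply: open_nbhs_nbhs; split; first exact: open_ereal_lt_ereal.
  by rewrite /= lte_fin.
apply: filterS => n; rewrite Lnorm2E /=.
set X := (\int[mu]_t _)%E => Xke.
have X0 : (0 <= X)%E by apply: integral_ge0 => t _; rewrite lee_fin sqr_ge0.
have {Xke}X_lt : (X < (k * e)%:E)%E.
  move: X0 Xke; case: X => [r|_|//]; last by rewrite poweRyr.
  rewrite lee_fin => r0; rewrite poweR_EFin powR12_sqrt// !lte_fin.
  by rewrite ltr_sqrt// mulr_gt0.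
rewrite -(@lte_pmul2l _ k%:E)// -EFinM; apply: le_lt_trans X_lt.
rewrite -integral_cst//.
apply: (@le_trans _ _ (\int[mu]_(t in E_ n) ((a_ n t - a t) ^+ 2)%:E)%E).
  apply: ge0_le_integral => //.
  - by move=> t _; rewrite lee_fin ltW.
  - exact: measurable_funTS.
  - by move=> t /= ?; rewrite lee_fin ka.
apply: ge0_subset_integral => //.
by move=> t _; rewrite lee_fin sqr_ge0.
Qed.

(** The squared norm of the difference is at most a constant times the integral
of [f^2] over [E_ n], which tends to 0 by absolute continuity. *)
Lemma bounded_mul_cvg (a_ : nat -> T -> R) (a : T -> R) (C : R)
    (ma_ : forall n, measurable_fun setT (a_ n)) (ma : measurable_fun setT a)
    (a_C : forall n t, `|a_ n t| <= C) (aC : forall t, `|a t| <= C)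
    (E_ : nat -> set T) f :
  (forall n, measurable (E_ n)) -> (forall n t, ~ E_ n t -> a_ n t = a t) ->
  (forall e : R, 0 < e -> \forall n \near \oo, (mu (E_ n) < e%:E)%E) ->
  form_cvg L2dot (fun n => bounded_mul (ma_ n) (a_C n) f) (bounded_mul ma aC f).
Proof.
move=> mE_ aE mu0; apply/cvgrPdist_lt => e e0.
pose K := (2 * C) ^+ 2 + 1.
have K0 : 0 < K by rewrite /K ltr_wpDl// sqr_ge0.
have [r [r0 rP]] := integral_normr_continuous (L2fun_prod_integrable f f)
  (divr_gt0 e0 K0).
apply: filterS (mu0 r r0) => n muE.
have mE := mE_ n.
have := rP _ mE muE; set E := E_ n => intE.
rewrite sub0r normrN ger0_norm; last first.
  exact: (semi_inner_ge0 (L2dot_semi_inner mu)).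
move: intE; rewrite -(ltr_pM2l K0) mulrCA divff ?gt_eqF// mulr1.
apply: le_lt_trans.
set g := _ - _.
have iE : mu.-integrable E (EFin \o (fun t => `|f t * f t|)).
  have := L2fun_prod_integrable f f.
  move/(integrableS measurableT mE (@subsetT _ _)); exact: integrable_abse.
rewrite -RintegralZl//.
rewrite Rintegral_mkcond; apply: le_Rintegral => //.
- exact: L2fun_prod_integrable.
- have /(integrable_mkcond _ mE) := integrableZl mE K iE.
  by apply: eq_integrable => // t _; rewrite /= !patchE; case: ifP.
move=> t _; rewrite /g /= patchE; case: ifPn => [_|].
  rewrite -mulrBl -expr2 exprMn normrM -expr2 real_normK ?num_real//.
  rewrite ler_wpM2r ?sqr_ge0// -real_normK ?num_real// /K.
  have : `|a_ n t - a t| <= 2 * C.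
    by rewrite (le_trans (ler_normB _ _))//; have := a_C n t; have := aC t; lra.
  by have := normr_ge0 (a_ n t - a t); nra.
rewrite notin_setE => /aE {}aE.
rewrite (_ : (a_ n \* f - a \* f) t = a_ n t * f t - a t * f t)//.
by rewrite aE subrr mul0r.
Qed.

End bounded_multiplier.

(** * Classes of square integrable functions *)

Section L2_classes.
Context d (T : measurableType d) (R : realType).
Variable mu : {measure set T -> \bar R}.
Local Notation L2 := (LspaceType2 mu).

Lemma L2class_Lfun (x : L2) : (x : T -> R) \in Lfun mu 2%:E.
Proof.
rewrite inE; apply/andP; split; rewrite inE/=; last exact: Lebesgue_finite.
pose r : {mfun T >-> measurableTypeR R} :=
  repr (x : {mfun_ mu, T >-> measurableTypeR R}).
exact: (@measurable_funPT _ _ _ _ r).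
Qed.

(** Sums and differences of representatives are formed in [L2fun], where they
are pointwise. *)
Definition L2rep (x : L2) : L2fun mu := Lfun_Sub (lee1n 2) (L2class_Lfun x).

Lemma L2dot_ae (f g h : L2fun mu) : ae_eq mu setT f g -> L2dot f h = L2dot g h.
Proof.
move=> fg; congr fine; apply: ae_eq_integral => //.
- by apply/measurable_EFinP; exact: measurable_funM.
- by apply/measurable_EFinP; exact: measurable_funM.
- by apply: filterS fg => t /= fgt _; rewrite fgt.
Qed.

Lemma L2rep_surj (f : L2fun mu) : exists x : L2, ae_eq mu setT (L2rep x) f.
Proof.
have mf : measurable_fun setT (f : T -> R) by [].
pose mf' := @isMeasurableFun.Build d _ T (measurableTypeR R) f mf.
pose f' : {mfun T >-> measurableTypeR R} :=
  HB.pack (f : T -> measurableTypeR R) mf'.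
pose q : {mfun_ mu, T >-> measurableTypeR R} := (\pi f')%qT.
have qf : ae_eq mu setT (q : T -> R) (f : T -> R).
  have : (repr q == f' %[mod {mfun_ mu, T >-> measurableTypeR R}])%qT.
    by rewrite reprK.
  by rewrite eqmodE => /asboolP.
have qfin : finite_norm mu 2%:E q.
  rewrite /finite_norm (_ : 'N[mu]_2[_] = 'N[mu]_2[EFin \o (f : T -> R)])%E.
    by rewrite Lnorm2_L2dot ltry.
  rewrite !Lnorm2E; congr (_ `^ _)%E; apply: ae_eq_integral => //.
  + apply/measurable_EFinP; apply: measurable_funX.
    exact: (@measurable_funPT _ _ _ _ (repr q)).
  + by apply/measurable_EFinP; apply: measurable_funX.
  + by apply: filterS qf => t /= qt _; rewrite qt.
pose m := isFinLebesgue.Build d T R mu 2%:E (lee1n 2) q qfin.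
pose x : L2 := HB.pack q m.
by exists x.
Qed.

End L2_classes.

(** * Weighted norms on Omega *)

Section L2_on_Omega.
Context (R : realType) (n : nat) (Omega : set (lebRn R n)).
Context (mOmega : measurable Omega).
Local Notation mu := (lebesgue_on mOmega).
Local Notation L2 := (L2 mOmega).
Local Notation L2dot := (@L2dot _ _ _ mu).
Local Notation rep := (@L2rep _ _ R mu).

Lemma l2distE (x x' : L2) :
  l2dist x x' = (Num.sqrt (L2dot (rep x - rep x') (rep x - rep x')))%:E.
Proof. by rewrite -Lnorm2_L2dot. Qed.

Lemma l2cvgP (x_ : nat -> L2) (x : L2) :
  l2cvg x_ x <-> form_cvg L2dot (rep \o x_) (rep x).
Proof.
have dot0 := semi_inner_ge0 (L2dot_semi_inner mu).
rewrite /l2cvg /form_cvg; under eq_fun do rewrite l2distE.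
pose s k := Num.sqrt (L2dot (rep (x_ k) - rep x) (rep (x_ k) - rep x)).
split=> [/fine_cvg h|h].
  have {h} s0 : s @ \oo --> 0 by exact: h.
  rewrite (_ : (fun k => _) = (fun k => s k * s k)).
    by rewrite -[0](mul0r 0); exact: cvgM.
  by apply/funext => k; rewrite -expr2 sqr_sqrtr.
apply/cvg_EFin; first exact: nearW.
by apply: (sqr_cvg0 _ h) => k; rewrite /= sqr_sqrtr.
Qed.

Lemma L2dot_rep_surj (f : L2fun mu) :
  exists x : L2, forall g, L2dot (rep x) g = L2dot f g.
Proof.
by have [x xf] := L2rep_surj f; exists x => g; exact: L2dot_ae.
Qed.

Section density.
Context (alpha : R) (alpha0 : 0 < alpha).

Definition density (A : set (lebRn R n)) t : R := weight A alpha t ^+ 2.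

Lemma densityE A t : density A t = if t \in A then alpha else 1.
Proof.
rewrite /density /weight; case: ifP => _; last by rewrite expr1n.
by rewrite sqr_sqrtr// ltW.
Qed.

Lemma measurable_weight (A : set (lebRn R n)) :
  measurable A -> measurable_fun setT (weight A alpha).
Proof.
move=> mA.
rewrite (_ : weight A alpha = (fun t => 1 + (Num.sqrt alpha - 1) * \1_A t)).
  apply: measurable_funD; first exact: measurable_cst.
  apply: measurable_funM; first exact: measurable_cst.
  exact: measurable_indic.
apply/funext => t; rewrite /weight indicE; case: (t \in A).
  by rewrite mulr1 addrC subrK.
by rewrite mulr0 addr0.
Qed.

Lemma measurable_density (A : set (lebRn R n)) :
  measurable A -> measurable_fun setT (density A).
Proof. by move=> mA; apply: measurable_funX; exact: measurable_weight. Qed.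

Lemma density_bounded A t : `|density A t| <= 1 + alpha.
Proof.
have a0 := ltW alpha0.
by rewrite densityE; case: ifP => _; rewrite ger0_norm// ?lerDl ?lerDr.
Qed.

Lemma density_ge A t : Num.min alpha 1 <= density A t.
Proof. by rewrite densityE ge_min; case: ifP => _; rewrite lexx ?orbT. Qed.

Definition density_mul (A : set (lebRn R n)) (mA : measurable A) :
    L2fun mu -> L2fun mu :=
  bounded_mul (measurable_density mA) (density_bounded A).

Lemma density_mul_ge (A : set (lebRn R n)) (mA : measurable A) (f : L2fun mu) :
  Num.min alpha 1 * L2dot f f <= L2dot (density_mul mA f) f.
Proof. exact: bounded_mul_ge (density_ge A). Qed.

Lemma density_mul_le (A : set (lebRn R n)) (mA : measurable A) (f : L2fun mu) :
  L2dot (density_mul mA f) f <= (1 + alpha) * L2dot f f.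
Proof. exact: bounded_mul_le. Qed.

Lemma wnorm_sqrE (A : set (lebRn R n)) (mA : measurable A) (f : L2fun mu) :
  (wnorm mOmega A alpha f ^+ 2)%E = (L2dot (density_mul mA f) f)%:E.
Proof.
have ge0 : 0 <= L2dot (density_mul mA f) f.
  apply: Rintegral_ge0 => t _ /=.
  by rewrite -mulrA mulr_ge0 ?sqr_ge0// -expr2 sqr_ge0.
have : wnorm mOmega A alpha f = (Num.sqrt (L2dot (density_mul mA f) f))%:E.
  rewrite /wnorm /l2norm Lnorm2E -powR12_sqrt// -poweR_EFin; congr (_ `^ _)%E.
  rewrite /L2dot /Rintegral fineK; last first.
    apply: integrable_fin_num => //.
    exact: (L2fun_prod_integrable (density_mul mA f) f).
  by apply: eq_integral => t _ /=; rewrite exprMn -mulrA -expr2.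
by move=> ->; rewrite -EFin_expe sqr_sqrtr.
Qed.

(** Two weights differ either nowhere, when [sqrt alpha = 1], or by
[|sqrt alpha - 1|] wherever they differ. *)
Lemma density_mul_cvg (S_ : nat -> set (lebRn R n)) (S : set (lebRn R n))
    (mS_ : forall k, measurable (S_ k)) (mS : measurable S) (f : L2fun mu) :
  l2norm mOmega (weight (S_ k) alpha \- weight S alpha)
     @[k --> \oo] --> 0%E ->
  form_cvg L2dot (fun k => density_mul (mS_ k) f) (density_mul mS f).
Proof.
move=> Scvg.
pose E k := [set t | weight (S_ k) alpha t != weight S alpha t].
have mE k : measurable (E k).
  by apply: measurable_neq_fun; exact: measurable_weight.
pose kappa := if Num.sqrt alpha == 1 then 1 else (Num.sqrt alpha - 1) ^+ 2.
have kappa0 : 0 < kappa.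
  rewrite /kappa; case: eqVneq => // a1.
  by rewrite lt_def sqr_ge0 sqrf_eq0 subr_eq0 a1.
apply: (bounded_mul_cvg _ _ _ _ (E_ := E)) => //.
  by move=> k t /negP; rewrite negbK /density => /eqP ->.
apply: (@measure_cvg0_Lnorm2 _ _ _ mu (fun k => weight (S_ k) alpha)
  (weight S alpha) E kappa).
- exact: kappa0.
- by move=> k; exact: measurable_weight.
- exact: measurable_weight.
- exact: mE.
- move=> k t; rewrite /E /kappa /weight /=.
  case: ifP => _; case: ifP => _; rewrite ?eqxx//.
    by move=> /negPf ->.
  by rewrite eq_sym => /negPf ->; rewrite -sqrrN opprB.
- exact: Scvg.
Qed.

End density.
End L2_on_Omega.

(** * The data space *)

Section Hilbert_space.
Context (R : realType) (Y : completeNormedModType R).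
Context (dot : {dot Y for idfun}).
Context (dot_norm : forall u : Y, dot u u = `|u| ^+ 2).

Lemma Hilbert_semi_inner : semi_inner (dot : Y -> Y -> R).
Proof.
split=> [u v|a u v w|u].
- by rewrite (hermitian_subproof u v) expr0 mul1r.
- by rewrite linearPl.
- by rewrite dot_norm sqr_ge0.
Qed.

Lemma Hilbert_complete : complete_form (dot : Y -> Y -> R).
Proof.
move=> u_ u_cauchy.
have uc : cauchy (u_ @ \oo).
  apply/cauchy_exP => e e0; have [N NP] := u_cauchy _ (exprn_gt0 2 e0).
  exists (u_ N); exists N => // k /= Nk.
  have := NP N k (leqnn _) Nk; rewrite dot_norm => h.
  by rewrite -ball_normE /=; have := sqr_ltr_norm e0 h; rewrite normr_id.
have /cauchy_cvgP/cvg_ex[l ul] := uc.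
exists l; rewrite /form_cvg; under eq_fun do rewrite dot_norm expr2.
have h : `|u_ k - l| @[k --> \oo] --> (0 : R).
  have -> : (0 : R) = `|l - l| by rewrite subrr normr0.
  by apply: cvg_norm; apply: cvgB => //; exact: cvg_cst.
by rewrite -[0](mul0r 0); exact: cvgM.
Qed.

End Hilbert_space.

(** * Stability of the minimizers *)

Section stability.
Context (R : realType) (n : nat) (Omega : set (lebRn R n)).
Context (mOmega : measurable Omega).
Context (Y : completeNormedModType R) (dot : {dot Y for idfun}).
Hypothesis dot_norm : forall u : Y, dot u u = `|u| ^+ 2.
Context (D : set (L2 mOmega)) (F : L2 mOmega -> Y).
Hypothesis F_closed : weakly_seq_closed dot D F.
Context (yd : Y) (xs : L2 mOmega) (alpha : R).
Hypothesis alpha0 : 0 < alpha.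
Context (S : set (lebRn R n)) (mS : measurable S).
Context (S_ : nat -> set (lebRn R n)) (mS_ : forall k, measurable (S_ k)).
Hypothesis S_cvg : l2norm mOmega (weight (S_ k) alpha \- weight S alpha)
  @[k --> \oo] --> 0%E.
Context (x_ : nat -> L2 mOmega).
Hypothesis x_min : forall k, minimizer D (tikhonov F yd xs alpha (S_ k)) (x_ k).
Local Notation mu := (lebesgue_on mOmega).
Local Notation L2dot := (@L2dot _ _ _ mu).
Local Notation rep := (@L2rep _ _ R mu).

Let HP := L2dot_semi_inner mu.
Let YP := Hilbert_semi_inner dot_norm.

Let u_of x : L2fun mu := rep x - rep xs.
Let v_of x : Y := F x - yd.
Let J (A : set (lebRn R n)) (mA : measurable A) x : R :=
  dot (v_of x) (v_of x) + L2dot (density_mul alpha0 mA (u_of x)) (u_of x).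

Let tikhonovE (A : set (lebRn R n)) (mA : measurable A) x :
  tikhonov F yd xs alpha A x = (J mA x)%:E.
Proof.
by rewrite /J EFinD -wnorm_sqrE dot_norm.
Qed.

Let J_min k x : D x -> J (mS_ k) (x_ k) <= J (mS_ k) x.
Proof.
by move=> Dx; have := (x_min k).2 _ Dx; rewrite !(tikhonovE (mS_ k)) lee_fin.
Qed.

Let c := Num.min alpha 1.

Let c0 : 0 < c. Proof. by rewrite /c lt_min alpha0 ltr01. Qed.

(** [x_ 0] serves as the fixed competitor; the two terms bound the parts of its
J_k value that come from the data misfit and from the weighted norm *)
Let B := J mS (x_ 0%N) + (1 + alpha) * L2dot (u_of (x_ 0%N)) (u_of (x_ 0%N)).

Let J_bound k : J (mS_ k) (x_ k) <= B.
Proof.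
apply: le_trans (J_min k (x_min 0).1) _; rewrite /B /J lerD//.
  rewrite lerDl; apply: (le_trans _ (density_mul_ge alpha0 mS _)).
  by rewrite mulr_ge0 ?(ltW c0) ?(semi_inner_ge0 HP).
exact: density_mul_le.
Qed.

Let v_bounded k : dot (v_of (x_ k)) (v_of (x_ k)) <= B.
Proof.
apply: le_trans (J_bound k); rewrite /J lerDl.
apply: (le_trans _ (density_mul_ge alpha0 (mS_ k) _)).
by rewrite mulr_ge0 ?(ltW c0) ?(semi_inner_ge0 HP).
Qed.

Let u_bounded k : L2dot (u_of (x_ k)) (u_of (x_ k)) <= c^-1 * B.
Proof.
rewrite ler_pdivlMl//; apply: le_trans (J_bound k).
apply: le_trans (density_mul_ge alpha0 (mS_ k) _) _.
by rewrite lerDr (semi_inner_ge0 YP).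
Qed.

(** The weak limit lies in the domain, hence is an admissible competitor of each
[x_ k]; this is what [energy_minimizing_strong_cvg] asks for. *)
Lemma weak_limit_minimizer (phi : nat -> nat) (x : L2 mOmega) (z : Y) :
  {homo phi : i j / (i < j)%N} ->
  l2weak_cvg (x_ \o phi) x -> weak_cvg dot (F \o (x_ \o phi)) z ->
  l2cvg (x_ \o phi) x /\ minimizer D (tikhonov F yd xs alpha S) x.
Proof.
move=> hphi xx Fz.
have [Dx Fx] := F_closed (fun k => (x_min (phi k)).1) xx Fz.
pose M_ k : L2fun mu -> L2fun mu := density_mul alpha0 (mS_ (phi k)).
pose M : L2fun mu -> L2fun mu := density_mul alpha0 mS.
have M_sym k u v : L2dot (M_ k u) v = L2dot u (M_ k v).
  exact: bounded_mul_sym.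
have M_cvg u : form_cvg L2dot (M_ ^~ u) (M u).
  exact: (cvg_subseq hphi (density_mul_cvg alpha0 mS_ mS u S_cvg)).
have ux w : L2dot (u_of (x_ (phi k))) w @[k --> \oo] --> L2dot (u_of x) w.
  have [y yw] := L2dot_rep_surj w.
  under eq_fun do
    rewrite (dotBl HP) (semi_innerC HP _ w) -yw (semi_innerC HP (rep y)).
  rewrite (dotBl HP) (semi_innerC HP _ w) -yw (semi_innerC HP (rep y)).
  by apply: cvgB; [exact: xx|exact: cvg_cst].
have vx w : dot (v_of (x_ (phi k))) w @[k --> \oo] --> dot (v_of x) w.
  under eq_fun do rewrite (dotBl YP).
  by rewrite (dotBl YP) Fx; apply: cvgB; [exact: Fz|exact: cvg_cst].
have [ucvg Jcvg] := energy_minimizing_strong_cvg HP YP M_sym M_cvg c0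
  (fun k => density_mul_ge alpha0 (mS_ (phi k)))
  (fun k => u_bounded (phi k)) ux vx (fun k => J_min (phi k) Dx).
split.
  apply/l2cvgP; rewrite /form_cvg (_ : (fun k => _) = (fun k =>
    L2dot (u_of (x_ (phi k)) - u_of x) (u_of (x_ (phi k)) - u_of x))) //.
  apply/funext => k; rewrite /u_of.
  by rewrite (_ : rep (x_ (phi k)) - rep xs - (rep x - rep xs) =
    rep (x_ (phi k)) - rep x)// opprB addrA subrK.
split=> // x' Dx'; rewrite !(tikhonovE mS) lee_fin.
apply: (ler_cvg_to Jcvg (energy_cvg HP M_cvg (u := u_of x') (v := v_of x'))).
by apply: nearW => k; exact: J_min.
Qed.

Let x_bounded k : L2dot (rep (x_ k)) (rep (x_ k)) <=
  2 * (c^-1 * B) + 2 * L2dot (rep xs) (rep xs).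
Proof.
rewrite -[in leLHS](subrK (rep xs) (rep (x_ k))).
rewrite (le_trans (dotD_le HP _ _))// lerD2r ler_pM2l//; exact: u_bounded.
Qed.

Let F_bounded k : dot (F (x_ k)) (F (x_ k)) <= 2 * B + 2 * dot yd yd.
Proof.
rewrite -[in leLHS](subrK yd (F (x_ k))).
rewrite (le_trans (dotD_le YP _ _))// lerD2r ler_pM2l//; exact: v_bounded.
Qed.

Lemma F_weak_subsequence (phi : nat -> nat) :
  exists2 psi : nat -> nat, {homo psi : i j / (i < j)%N} &
    exists z, weak_cvg dot (F \o (x_ \o (phi \o psi))) z.
Proof.
exact: (weak_compactness YP (Hilbert_complete dot_norm)
  (fun k => F_bounded (phi k))).
Qed.

Lemma minimizers_subsequence :
  exists2 phi : nat -> nat, {homo phi : i j / (i < j)%N} &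
    exists x : L2 mOmega, l2cvg (x_ \o phi) x.
Proof.
have [phi hphi [f xf]] := weak_compactness HP (@L2_complete _ _ _ mu) x_bounded.
have [x xE] := L2dot_rep_surj f.
have [psi hpsi [z Fz]] := F_weak_subsequence phi.
exists (phi \o psi); first by move=> i j ij; apply: hphi; exact: hpsi.
exists x; apply: (weak_limit_minimizer _ _ Fz).1.
  by move=> i j ij; apply: hphi; exact: hpsi.
move=> y; apply: (cvg_subseq hpsi (u := fun k => l2dot (x_ (phi k)) y)).
by have := xf (rep y); rewrite -xE.
Qed.

(** Strong convergence of [x_ k] implies weak convergence; only [F (x_ k)] needs
a further subsequence. *)
Lemma minimizers_limit (phi : nat -> nat) (x : L2 mOmega) :
  {homo phi : i j / (i < j)%N} -> l2cvg (x_ \o phi) x ->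
  minimizer D (tikhonov F yd xs alpha S) x.
Proof.
move=> hphi /l2cvgP xx.
have [psi hpsi [z Fz]] := F_weak_subsequence phi.
apply: (weak_limit_minimizer _ _ Fz).2.
  by move=> i j ij; apply: hphi; exact: hpsi.
move=> y; apply: (cvg_subseq hpsi (u := fun k => l2dot (x_ (phi k)) y)).
exact: (form_cvg_weak HP (v := rep y) xx).
Qed.

End stability.

Theorem theoremA2 (R : realType) (n : nat)
  (Omega : set (lebRn R n)) (mOmega : measurable Omega)
  (bOmega : bounded_set (Omega : set 'rV[R]_n.+1))
  (Y : completeNormedModType R) (dot : {dot Y for idfun})
  (dot_norm : forall u : Y, dot u u = `|u| ^+ 2)
  (D : set (L2 mOmega)) (F : L2 mOmega -> Y)
  (F_cont : continuous_op D F) (F_closed : weakly_seq_closed dot D F)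
  (S : set (lebRn R n)) (mS : measurable S) (S_sub : S `<=` Omega)
  (y : Y) (xdag xstar : L2 mOmega)
  (supp_xstar : supp_in S xstar)
  (xdag_min : minimizer
     [set x | [/\ D x, F x = y & supp_in S x]] (fun x => l2dist x xstar) xdag)
  (delta : R) (ydelta : Y) (noise : `|ydelta - y| <= delta)
  (alpha : R) (alpha_gt0 : 0 < alpha)
  (S_ : nat -> set (lebRn R n)) (mS_ : forall k, measurable (S_ k))
  (S_sub_ : forall k, S_ k `<=` Omega)
  (S_cvg : l2norm mOmega (weight (S_ k) alpha \- weight S alpha)
     @[k --> \oo] --> 0%E)
  (x_ : nat -> L2 mOmega)
  (x_min : forall k,
     minimizer D (tikhonov F ydelta xstar alpha (S_ k)) (x_ k)) :
  (exists2 phi : nat -> nat, {homo phi : i j / (i < j)%N} &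
     exists x : L2 mOmega, l2cvg (x_ \o phi) x) /\
  (forall (phi : nat -> nat) (x : L2 mOmega),
     {homo phi : i j / (i < j)%N} -> l2cvg (x_ \o phi) x ->
     minimizer D (tikhonov F ydelta xstar alpha S) x).
Proof.
split; last first.
  exact: (minimizers_limit dot_norm F_closed alpha_gt0 mS mS_ S_cvg x_min).
exact: (minimizers_subsequence dot_norm F_closed alpha_gt0 mS mS_ S_cvg x_min).
Qed.
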